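(* Let $1\le a\le b$ be integers, $l=b-a$, and consider the following two expansions of $\mathrm{KTp}_{\mathcal A_2}^{a\to b}$ in the double stable Grothendieck polynomials $G_{p,q}=G_{p,q}(\alpha_1^{-1},\ldots,\alpha_a^{-1};\beta_1^{-1},\ldots,\beta_b^{-1})$: (i) (stable expansion, for any integer $N>2l+2$) $\displaystyle \sum_{r=0}^{N}\sum_{s=-r-1}^{-\lfloor r/2\rfloor}d_{r,s}\,G_{r+l+1,\,s+l+2}$; (ii) (minimal expansion) $\displaystyle \sum_{r=0}^{2l+2}\sum_{s=-l-2}^{-\lfloor r/2\rfloor}D_{r,s,l}\,G_{r+l+1,\,s+l+2}$, where $D_{r,s,l}=d_{r,s}$ if $s>-l-2$ and $D_{r,s,l}=\sum_{t=-\infty}^{-l-2}d_{r,t}$ if $s=-l-2$. In both expansions, the coefficient of $G_{p,q}$ has sign $(-1)^{p+q}$; that is, $(-1)^{p+q}$ times the coefficient of $G_{p,q}$ is nonnegative.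
   Context: **Coefficients $d_{r,s}$.** The integers $d_{r,s}$ are the coefficients of the Laurent expansion \[ \frac{1-2x_1+x_1^2}{x_2-2x_1+x_1^2}=\sum_{r,s}d_{r,s}\,x_1^r x_2^s \] in the region where $|x_1|$ is small compared to $|x_2|$, i.e. the expansion $(1-2x_1+x_1^2)\sum_{k\ge1}x_2^{-k}(2x_1-x_1^2)^{k-1}$, a power series in $x_1$ whose coefficients are polynomials in $x_2^{-1}$. ''Coefficient of $G_{p,q}$'' means the number multiplying the symbol $G_{p,q}$ in the displayed sums (each index pair occurs at most once). **Double stable Grothendieck polynomials $G_I$.** Write $\mathrm{Res}_{z=0,\infty} f\,dz=\mathrm{Res}_{z=0} f\,dz+\mathrm{Res}_{z=\infty} f\,dz$. For $I\in\mathbb Z^n$, \[ G_I(x_1,\ldots,x_k;y_1,\ldots,y_m)=\mathrm{Res}_{z_1=0,\infty}\cdots\mathrm{Res}_{z_n=0,\infty}\left(\prod_{j=1}^n(1-z_j)^{I_j-j}\prod_{1\le j<i\le n}\left(1-\frac{z_i}{z_j}\right)\prod_{j=1}^n\frac{\prod_{i=1}^m(1-z_jy_i)}{\prod_{i=1}^k(1-z_jx_i)(1-z_j)^{m-k}}\prod_{j=1}^n\frac{dz_j}{z_j}\right). \] **The K-theoretic Thom polynomial.** Let $V=J^2(\mathbb C^a,\mathbb C^b)$ be the vector space of 2-jets of maps $(\mathbb C^a,0)\to(\mathbb C^b,0)$, with the action of $G=GL_a(\mathbb C)\times GL_b(\mathbb C)$ by linear reparametrizations. The local algebra of $h=(h_1,\ldots,h_b)\in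 V$ is the quotient by $(h_1,\ldots,h_b)$ of the ring of polynomials in $a$ variables modulo monomials of degree at least $3$. Let $X\subset V$ be the Zariski closure of the set of jets whose local algebra is isomorphic to $\mathbb C[x]/(x^3)$. Let $T\subset G$ be the diagonal maximal torus, and $\alpha_1,\ldots,\alpha_a$, $\beta_1,\ldots,\beta_b$ the characters of $T$ on the standard representations $\mathbb C^a$, $\mathbb C^b$. Then $\mathrm{KTp}_{\mathcal A_2}^{a\to b}=\tilde\chi_X/\chi_V$, where $\tilde\chi_X(\tau)=\sum_i(-1)^i\mathrm{Tr}[\tau\,|\,H^i(Y,\mathcal O_Y)]$ for any smooth $T$-equivariant resolution $Y\to X$, and $\chi_V=\prod_j(1-\eta_j^{-1})^{-1}$ is the $T$-character of the ring of polynomial functions on $V$, $\eta_j$ running over the $T$-weights of $V$ written as characters. Both displayed sums are known to equal $\mathrm{KTp}_{\mathcal A_2}^{a\to b}$. *)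

(* Defs.v *)
From HB Require Import structures.
From mathcomp Require Import all_boot all_order all_algebra.
From mathcomp Require Import classical_sets fsbigop.
From mathcomp Require Import monalg.

Set Implicit Arguments.
Unset Strict Implicit.
Unset Printing Implicit Defensive.

Import Order.TTheory GRing.Theory Num.Theory.

Local Open Scope classical_set_scope.
Local Open Scope ring_scope.

(* In the region |x1| << |x2|, grouping
     (1 - 2 x1 + x1^2) / (x2 - 2 x1 + x1^2)
       = \sum_(k >= 1) x2^-k (1 - 2 x1 + x1^2) (2 x1 - x1^2)^(k - 1)
   by powers of x2, the coefficient of x2^s is a polynomial in 'X = x1. *)
Definition x2coef (s : int) : {poly int} :=
  if s < 0 then (1 - 'X *+ 2 + 'X^2) * ('X *+ 2 - 'X^2) ^+ `|s|%N.-1 else 0.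

Definition d (r : nat) (s : int) : int := (x2coef s)`_r.

(* (x2 - 2 x1 + x1^2) * \sum_s x2coef s * x2^s = 1 - 2 x1 + x1^2, read off
   at each power of x2. *)
Lemma x2coefP (s : int) :
  x2coef (s - 1) - ('X *+ 2 - 'X^2) * x2coef s =
  if s == 0 then 1 - 'X *+ 2 + 'X^2 else 0.
Proof.
case: s => [[|n]|n].
- by rewrite /x2coef /= mulr0 subr0 expr0 mulr1.
- have -> : Posz n.+1 - 1 = Posz n by rewrite intS addrC addKr.
  by rewrite /x2coef /= mulr0 subr0.
have -> : Negz n - 1 = Negz n.+1 by rewrite !NegzE (intS n.+1) opprD addrC.
by rewrite /x2coef /= [_ ^+ n.+1]exprS mulrCA subrr.
Qed.

Lemma d_eq0 (r : nat) (s : int) : s < - r%:Z - 1 -> d r s = 0.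
Proof.
case: s => n hs.
  have : Posz n < 0 by apply: (lt_le_trans hs); rewrite -opprD oppr_le0.
  by [].
have hrn : (r < n)%N.
  by move: hs; rewrite NegzE -opprD ltrN2 -PoszD ltz_nat addn1 ltnS.
rewrite /d /x2coef /=.
have -> : 'X *+ 2 - 'X^2 = (2%:R - 'X) * 'X :> {poly int}.
  by rewrite mulrBl mulr_natl.
by rewrite exprMn mulrA coefMXn hrn.
Qed.

(* The series of the case s = - l - 2 is finitely supported, by d_eq0, so the
   \sum_(t \in _) of fsbigop is its sum. *)
Definition D (r : nat) (s : int) (l : nat) : int :=
  if s == - l%:Z - 2 then \sum_(t \in [set t : int | t <= - l%:Z - 2]) d r t
  else d r s.

(* {malg int[int * int]} is the free abelian group on symbols G_{p,q} indexed
   by pairs of integers: << c *g (p, q) >> is c G_{p,q}, and g@_(p, q) is the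
   coefficient of G_{p,q} in g.  In both sums s = - k, so
   - r - 1 <= s <= - floor(r/2) reads r./2 <= k < r.+2, and
   - l - 2 <= s <= - floor(r/2) reads r./2 <= k < l.+3. *)
Definition stable_expansion (l N : nat) : {malg int[(int * int)%type]} :=
  \sum_(0 <= r < N.+1) \sum_(r./2 <= k < r.+2)
    let s : int := - k%:Z in
    << d r s *g (r%:Z + l%:Z + 1, s + l%:Z + 2) >>.

Definition minimal_expansion (l : nat) : {malg int[(int * int)%type]} :=
  \sum_(0 <= r < (2 * l + 2).+1) \sum_(r./2 <= k < l.+3)
    let s : int := - k%:Z in
    << D r s l *g (r%:Z + l%:Z + 1, s + l%:Z + 2) >>.

(* Main.v *)
(* With u = 2 x1 - x1^2 one has 1 - 2 x1 + x1^2 = 1 - u, so the coefficient of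
   x2^-k is (1 - u) u^(k - 1), and the tail over k >= l + 2 telescopes to
   u^(l + 1).  Both are x1^n times a product of factors 1 - x1 and 2 - x1, whose
   coefficients alternate in sign. *)
Require Import Defs.
From mathcomp Require Import all_boot all_order all_algebra.
From mathcomp Require Import classical_sets fsbigop.
From mathcomp Require Import zify.
From mathcomp Require Import monalg.

Import Order.TTheory GRing.Theory Num.Theory.
Local Open Scope ring_scope.

Definition alternating {R : numDomainType} (p : {poly R}) : Prop :=
  forall i : nat, 0 <= (-1) ^+ i * p`_i.

Lemma alternating1 (R : numDomainType) : alternating (1 : {poly R}).
Proof. by case=> [|i]; rewrite coef1 ?mulr1 ?mulr0. Qed.

(** Alternation says that [p(-x)] has nonnegative coefficients, a property stable under products. *)
Lemma alternatingM (R : numDomainType) (p q : {poly R}) :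
  alternating p -> alternating q -> alternating (p * q).
Proof.
move=> hp hq i; rewrite coefM mulr_sumr; apply: sumr_ge0 => j _.
by rewrite -{1}(subnKC (leq_ord j)) exprD mulrACA mulr_ge0.
Qed.

Lemma alternatingX (R : numDomainType) (p : {poly R}) (n : nat) :
  alternating p -> alternating (p ^+ n).
Proof.
move=> hp; elim: n => [|n IHn]; first exact: alternating1.
by rewrite exprS; apply: alternatingM.
Qed.

Lemma alternatingCBX (R : numDomainType) (c : R) :
  0 <= c -> alternating (c%:P - 'X).
Proof.
move=> c_ge0 [|[|i]]; rewrite coefB coefC coefX /=.
- by rewrite subr0 mul1r.
- by rewrite sub0r expr1 mulrN1 opprK.
- by rewrite subr0 mulr0.
Qed.

Lemma coef_alternatingMXn (R : numDomainType) (p : {poly R}) (n r : nat) :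
  alternating p -> 0 <= (-1) ^+ (r + n) * (p * 'X^n)`_r.
Proof.
move=> hp; rewrite coefMXn; case: ltnP => [_|le_nr]; first by rewrite mulr0.
(* [r + n = (r - n) + 2n], so the sign is that of the coefficient of [p] at [r - n]. *)
rewrite -{1}(subnK le_nr) -addnA exprD addnn -mul2n exprM sqrrN expr1n expr1n.
by rewrite mulr1.
Qed.

Lemma expX2B (n : nat) :
  ('X *+ 2 - 'X^2) ^+ n = (2%:P - 'X) ^+ n * 'X^n :> {poly int}.
Proof. by rewrite -exprMn mulrBl mul_polyC scaler_nat. Qed.

Lemma coef_expX2B_sign (n r : nat) :
  0 <= (-1) ^+ (r + n) * (('X *+ 2 - 'X^2) ^+ n : {poly int})`_r.
Proof.
rewrite expX2B; apply: coef_alternatingMXn.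
by apply: alternatingX; apply: alternatingCBX.
Qed.

(** For [k = n + 1] the polynomial is [(1 - x)^2 (2 - x)^n x^n]; the shift from [k] to [n] accounts
    for the extra sign. *)
Lemma d_sign (r k : nat) : 0 <= (-1) ^+ (r + k).+1 * d r (- k%:Z).
Proof.
case: k => [|n]; first by rewrite /d /x2coef coef0 mulr0.
rewrite addnS 2!exprS !mulN1r opprK /d /x2coef -NegzE /= expX2B mulrA.
apply: coef_alternatingMXn; apply: alternatingM; last first.
  by apply: alternatingX; apply: alternatingCBX.
have -> : 1 - 'X *+ 2 + 'X^2 = (1%:P - 'X) ^+ 2 :> {poly int}.
  by rewrite sqrrB expr1n mul1r.
by apply: alternatingX; apply: alternatingCBX.
Qed.

Lemma D_tail (r l : nat) :
  D r (- l%:Z - 2) l = (('X *+ 2 - 'X^2) ^+ l.+1 : {poly int})`_r.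
Proof.
set u : {poly int} := 'X *+ 2 - 'X^2.
rewrite /D eqxx.
(* With [t = -(n + 1)], the tail starts at [n = l + 1]. By [d_eq0] all terms with [n > r] vanish;
   the bound [l + r + 2] exceeds [r] and keeps the range nonempty even when [r] is small. *)
rewrite (fsbigE [seq - n.+1%:Z | n <- index_iota l.+1 (l + r).+2]); first last.
- move=> t /= le_t /negP t_out; apply: d_eq0.
  rewrite ltNge; apply/negP => ge_t; apply: t_out; apply/mapP.
  by exists (`|t|%N.-1); [rewrite mem_index_iota; lia | lia].
- by move=> t /= /mapP[n]; rewrite mem_index_iota => n_in ->; lia.
- by rewrite map_inj_uniq ?iota_uniq // => m n; lia.
rewrite big_map big_seq_cond.
rewrite (eq_bigl (fun n => n \in index_iota l.+1 (l + r).+2)); last first.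
  move=> n; case n_in: (n \in _) => //=; apply/mem_set => /=.
  by move: n_in; rewrite mem_index_iota; lia.
rewrite -big_seq (eq_bigr (fun n => - ((u ^+ n.+1)`_r - (u ^+ n)`_r))).
  rewrite sumrN telescope_sumr; last by rewrite ltnW // !ltnS leq_addr.
  (* The far boundary term [u^(l + r + 2)] is divisible by [x^(l + r + 2)], so it does not reach
     degree [r]. *)
  by rewrite opprB /u [_ ^+ (l + r).+2]expX2B coefMXn ltnS leqW ?leq_addl ?subr0.
move=> n _; rewrite opprB -coefB /d /x2coef -NegzE /= -/u.
have -> : 1 - 'X *+ 2 + 'X^2 = 1 - u by rewrite opprB addrA addrAC.
by rewrite exprS mulrBl mul1r.
Qed.

Lemma D_sign (r k l : nat) : 0 <= (-1) ^+ (r + k).+1 * D r (- k%:Z) l.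
Proof.
have [->|ne_k] := eqVneq k l.+2.
  have -> : - l.+2%:Z = - l%:Z - 2 by lia.
  (* At [k = l + 2] the exponents [r + k + 1] and [r + (l + 1)] differ by 2, so the tail [u^(l + 1)]
     has the same sign as a single [d]. *)
  rewrite D_tail addnS 2!exprS !mulN1r opprK.
  exact: coef_expX2B_sign.
by rewrite /D ifN; [exact: d_sign | lia].
Qed.

Lemma mcoeffU_sign (l r k : nat) (c p q : int) : 0 <= (-1) ^+ (r + k).+1 * c ->
  0 <= (-1 : int) ^ (p + q) *
    << c *g (r%:Z + l%:Z + 1, - k%:Z + l%:Z + 2) >>@_(p, q).
Proof.
move=> hc; rewrite mcoeffU; case: eqP => [[<- <-]|_]; last by rewrite mulr0.
(* Only the parity of [p + q] matters; the difference from [r + k + 1] is even but may be negative,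
   hence integer exponents. *)
have -> : r%:Z + l%:Z + 1 + (- k%:Z + l%:Z + 2) =
    (r + k).+1%:Z + 2 * (l%:Z + 1 - k%:Z) by lia.
by rewrite exprzDr // -exprz_exp (_ : (-1) ^ 2 = 1) // exp1rz mulr1 mulr1n.
Qed.

Theorem theorem9p1 (a b l : nat) (ha : (1 <= a)%N) (hab : (a <= b)%N)
    (hl : l = (b - a)%N) :
  (forall N : nat, (2 * l + 2 < N)%N ->
     forall p q : int,
       0 <= (-1 : int) ^ (p + q) * (stable_expansion l N)@_(p, q)) /\
  (forall p q : int,
     0 <= (-1 : int) ^ (p + q) * (minimal_expansion l)@_(p, q)).
Proof.
(* Taking the coefficient at [(p, q)] is additive, so the sign can be checked on each summand. *)
split=> [N _|] p q; rewrite raddf_sum mulr_sumr; apply: sumr_ge0 => r _;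
  rewrite raddf_sum mulr_sumr; apply: sumr_ge0 => k _; apply: mcoeffU_sign.
- exact: d_sign.
- exact: D_sign.
Qed.
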